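(* Let $(d_k,d_{k-1},\ldots,d_0)_b$ be a shifted-symmetric $(n,b)$-palintiple with carries $c_k,c_{k-1},\ldots,c_0$, and let $D=\gcd(d_0,b^2-1)$. Suppose $n^2-1$ divides $Dc_j$ with quotient $q_j$ for all $0\le j\le k$. Then for every integer $\alpha\ge 1$ such that $D$ divides $\alpha(b\,d_{k-j+2}+d_j)-(nq_j+q_{j-1})$ for all $0\le j\le k$, there exists an asymmetric $(k+3)$-digit $(b,\hat{b})$-palintiple with carries $(\hat{c}_{k+2},\hat{c}_{k+1},\ldots,\hat{c}_0)=(0,d_k,d_{k-1},\ldots,d_0,0)$, where $\hat{b}=\alpha\,\frac{b^2-1}{D}$.
   Context: For integers $1<n<b$ and $k\ge 1$, write $(d_k,\ldots,d_0)_b=\sum_{j=0}^k d_jb^j$ with digits $0\le d_j<b$. It is called a $(k+1)$-digit $(n,b)$-palintiple (with multiplier $n$ and base $b$) if $d_k\neq 0$ (no leading zeros) and $(d_k,d_{k-1},\ldots,d_0)_b=n\,(d_0,d_1,\ldots,d_k)_b$. Its carries $c_k,\ldots,c_0$ are those of the base-$b$ single-digit multiplication: $c_0=0$ and $n d_{k-j}+c_j=d_j+b\,c_{j+1}$ for $0\le j\le k$ (so $c_{j+1}=\lfloor (n d_{k-j}+c_j)/b\rfloor$), with $c_{k+1}=0$. By convention, quantities with out-of-range indices are zero: $d_{k+1}=d_{k+2}=0$ and $q_{-1}=0$. The palintiple is symmetric if $c_j=c_{k-j}$ for all $0\le j\le k$; shifted-symmetric if $c_j=c_{k-j+1}$ for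 all $0\le j\le k$; asymmetric if it is neither symmetric nor shifted-symmetric (for a palintiple with $K+1$ digits, replace $k$ by $K$ in these definitions). *)

(* Defs.v *)
From mathcomp Require Import all_boot.

Set Implicit Arguments.
Unset Strict Implicit.
Unset Printing Implicit Defensive.

(* Digits and carries are stored least significant first: the tuple
   [:: x_0; ...; x_k] stands for (x_k, ..., x_0).  Since x`[j] has default 0,
   digits and carries with an index larger than k are 0; in particular
   the condition c_(k+1) = 0 on carries is built in. *)
Notation "x `[ j ]" := (nth 0%N x j) (at level 2, format "x `[ j ]") : nat_scope.

Definition base_value (b : nat) (x : seq nat) : nat :=
  \sum_(j < size x) x`[j] * b ^ j.

Definition palintiple (n b k : nat) (d : k.+1.-tuple nat) : Prop :=
  [/\ 1 < n < b, 1 <= k, (forall j, j <= k -> d`[j] < b), d`[k] != 0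
    & base_value b d = n * base_value b (rev d)].

Definition is_carries (n b k : nat) (d c : k.+1.-tuple nat) : Prop :=
  c`[0] = 0 /\
  forall j, j <= k -> n * d`[k - j] + c`[j] = d`[j] + b * c`[j.+1].

Definition symmetric_carries (k : nat) (c : k.+1.-tuple nat) : Prop :=
  forall j, j <= k -> c`[j] = c`[k - j].

Definition shifted_symmetric_carries (k : nat) (c : k.+1.-tuple nat) : Prop :=
  forall j, j <= k -> c`[j] = c`[k - j + 1].

Definition asymmetric_carries (k : nat) (c : k.+1.-tuple nat) : Prop :=
  ~ symmetric_carries c /\ ~ shifted_symmetric_carries c.

(* The term q_(j-1), with the convention q_(-1) = 0. *)
Definition prev_term (q : nat -> nat) (j : nat) : nat :=
  if j is i.+1 then q i else 0.

(* Main.v *)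
Require Import Defs.
From mathcomp Require Import all_boot all_order all_algebra.
From mathcomp Require Import zify.

(** The carry equations determine the digits.  Writing down the equation at
    position j and at the mirror position K - j of a palintiple with multiplier
    b, base B, digits e and carries s gives a 2 x 2 linear system in e_j and
    e_(K-j), of determinant b^2 - 1, whose solution is

      (b^2 - 1) e_j = B (s_(j+1) + b s_(K-j+1)) - (s_j + b s_(K-j)).

    So one may start from the wanted carries s = (0, d_k, ..., d_0, 0), take this
    formula as the definition of e, and check that every e_j is an integer in
    [0, B).  Both brackets lie in [0, b^2 - 1] because the carries are
    digits in base b.  Hence the right-hand side is larger than -(b^2 - 1) and
    smaller than (b^2 - 1) B outside two extreme configurations, and divisibility
    by b^2 - 1 then puts e_j in [0, B) (lemma [digit_of_congruence]).

    The rest comes from the shifted-symmetric palintiple d.  Its own 2 x 2 system,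
    simplified by the symmetry of c, reads

      (n^2 - 1) d_j = (b - n) c_(j+1) + (n b - 1) c_j.

    Integrality: it implies (n^2 - 1) (d_j + b d_(k-j)) =
    (b^2 - 1) (n c_(j+1) + c_j), so the second bracket is
    (n q_j + q_(j-1)) (b^2 - 1) / D, and as B = alpha (b^2 - 1) / D the hypothesis
    on alpha is exactly the divisibility of the right-hand side by b^2 - 1, for
    j <= k.  The top two positions mirror the positions 1 and 0, and the
    mirror image of a right-hand side is b times it modulo b^2 - 1
    ([mirror_opposite]).

    Range: since all coefficients in the formula for d_j are positive, a zero
    digit d_j forces c_j = c_(j+1) = 0; this is what excludes the two extreme
    configurations ([mirror_digits_eq0] and [mirror_digits_not_extreme]).

    Asymmetry: symmetric carries would force d_0 = d_k and shifted-symmetric ones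
    d_0 = 0, but d_k = n d_0 + c_1 with d_0 > 0. *)

Set Implicit Arguments.
Unset Strict Implicit.
Unset Printing Implicit Defensive.

(** * Palintiples from their carries *)

(** Summing the carry equations with weights b^j telescopes the carries, and
    both boundary terms c_0 and c_(k+1) vanish. *)
Lemma palintiple_of_carries n b k (d c : k.+1.-tuple nat) :
  1 < n < b -> 1 <= k -> (forall j, j <= k -> d`[j] < b) -> d`[k] != 0 ->
  is_carries n b d c -> palintiple n b d.
Proof.
move=> hnb hk hdb hd0 [c0 hc]; split => //.
have telescope m : m <= k.+1 ->
    \sum_(j < m) d`[j] * b ^ j + b ^ m * c`[m]
    = \sum_(j < m) n * (d`[k - j] * b ^ j).
  elim: m => [|m IHm] hm; first by rewrite !big_ord0 c0 muln0.
  rewrite !big_ord_recr /= -IHm ?(ltnW hm) // expnS.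
  have := congr1 (muln (b ^ m)) (hc m hm).
  by move: (b ^ m) (\sum_(_ < m) _) => w S; nia.
have := telescope k.+1 (leqnn _); rewrite (nth_default _ (n := k.+1)) ?size_tuple //.
rewrite muln0 addn0 /base_value size_rev big_distrr /= size_tuple => ->.
by apply: eq_bigr => j _; rewrite nth_rev ?size_tuple ?ltn_ord.
Qed.

(** The shape of both brackets in the solution of the carry equations: position
    j paired with its mirror image in 0..K. *)
Definition mirror (b K : nat) (s : seq nat) (j : nat) : nat :=
  s`[j] + b * s`[K - j].

Lemma mirror_opposite b K s j : 0 < b -> j <= K ->
  b * mirror b K s j = mirror b K s (K - j) + (b ^ 2 - 1) * s`[K - j].
Proof. by move=> hb hj; rewrite /mirror subKn //; nia. Qed.

Lemma mirror_le b K s j : 0 < b -> (forall i, s`[i] < b) ->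
  mirror b K s j <= b ^ 2 - 1.
Proof.
by move=> hb hs; have := hs j; have := hs (K - j); rewrite /mirror; nia.
Qed.

(** The 2 x 2 system solved backwards; stated without subtraction so that
    everything stays in the natural numbers. *)
Lemma carries_of_digits b B K (e : nat -> nat) s : 1 < b ->
  (forall j, j <= K ->
     (b ^ 2 - 1) * e j + mirror b K s j = B * mirror b K (behead s) j) ->
  forall j, j <= K -> b * e (K - j) + s`[j] = e j + B * s`[j.+1].
Proof.
move=> hb he j hj; have := he j hj; have := he (K - j) (leq_subr _ _).
rewrite /mirror subKn // !nth_behead.
have [N eN] : exists N, b ^ 2 = N.+2.
  by exists (b ^ 2 - 2); have : 2 <= b ^ 2 by [nia]; lia.
rewrite eN subn1 /= => e1 e2.
(* eliminate the opposite digit between the two equations *)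
have e3 : N.+1 * (b * e (K - j) + s`[j]) = N.+1 * (e j + B * s`[j.+1]).
  have := congr1 (muln b) e1.
  have : b * (b * s`[j]) = N.+2 * s`[j] by rewrite mulnA -eN; lia.
  have : b * (b * (B * s`[j.+1])) = N.+2 * (B * s`[j.+1]) by rewrite mulnA -eN; lia.
  by nia.
by apply/eqP; rewrite -(eqn_pmul2l (m := N.+1)) //; apply/eqP.
Qed.

(** The quotient (B X - Y) / N lies strictly between -1 and B, except possibly
    when X = 0 < Y or when X = N and Y = 0. *)
Lemma digit_of_congruence N B X Y : 0 < N -> 0 < B -> X <= N -> Y <= N ->
  (X = 0 -> Y = 0) -> ~ (X = N /\ Y = 0) ->
  (N %| (B * X)%N%:Z - Y%:Z)%Z%R ->
  exists2 e, e < B & N * e + Y = B * X.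
Proof.
move=> hN hB hX hY hX0 hXN /dvdzP [z ez].
have z_ge0 : (0 <= z)%R by case: (posnP X) => [/[dup] /hX0|]; nia.
have z_lt : (z < B%:Z)%R.
  case: (ltnP X N) => hXN'; first by nia.
  have Y_gt0 : 0 < Y by case: (posnP Y) => // Y0; case: hXN; lia.
  by nia.
by exists `|z|%N; nia.
Qed.

(** * Shifted-symmetric palintiples *)

Section ShiftedSymmetric.

Variables (n b k : nat) (d c : k.+1.-tuple nat).
Hypotheses (hd : palintiple n b d) (hc : is_carries n b d c).
Hypothesis hshift : shifted_symmetric_carries c.

Lemma digit_lt j : d`[j] < b.
Proof.
case: hd => [hnb _ hdb _ _]; case: (leqP j k) => [|hj]; first exact: hdb.
by rewrite nth_default ?size_tuple //; lia.
Qed.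

Lemma shifted_mirror_carry j : j <= k -> c`[k - j] = c`[j.+1].
Proof. by move=> hj; rewrite hshift ?leq_subr // subKn // addn1. Qed.

(** The carry equation at k - j, where shifted symmetry exchanges the two
    carries of the equation at j. *)
Lemma shifted_carry_opposite j : j <= k ->
  n * d`[j] + c`[j.+1] = d`[k - j] + b * c`[j].
Proof.
case: hc => _ hcj hj; have := hcj _ (leq_subr j k).
by rewrite subKn // shifted_mirror_carry // -(addn1 (k - j)) -hshift.
Qed.

Lemma shifted_digit j : j <= k ->
  (n ^ 2 - 1) * d`[j] = (b - n) * c`[j.+1] + (n * b - 1) * c`[j].
Proof.
case: hd => [hnb _ _ _ _] hj; have := shifted_carry_opposite hj.
case: hc => _ /(_ j hj).
have [r eb] : exists r, b = n + r by [exists (b - n); lia].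
have [t en] : exists t, n = t.+1 by [exists n.-1; lia].
by rewrite eb en => e1 /(congr1 (muln t.+1)) e2; nia.
Qed.

Lemma shifted_digit_pair j : j <= k ->
  (n ^ 2 - 1) * (d`[j] + b * d`[k - j]) = (b ^ 2 - 1) * (n * c`[j.+1] + c`[j]).
Proof.
case: hd => [hnb _ _ _ _] hj; have e1 := shifted_digit hj.
have := shifted_digit (leq_subr j k).
rewrite shifted_mirror_carry // -(addn1 (k - j)) -hshift // => e2.
rewrite mulnDr mulnCA e1 e2.
have [r eb] : exists r, b = n + r by [exists (b - n); lia].
have [t en] : exists t, n = t.+1 by [exists n.-1; lia].
have -> : n * b - 1 = t * b + t + r by lia.
have -> : b ^ 2 - 1 = (t + r) * b + t + r by lia.
have -> : b - n = r by lia.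
by rewrite eb en; lia.
Qed.

Lemma shifted_digit_eq0 j : d`[j] = 0 -> c`[j] = 0 /\ c`[j.+1] = 0.
Proof.
case: hd => [hnb _ _ _ _] dj0; case: (leqP j k) => hj; last first.
  by rewrite !nth_default ?size_tuple // ltnW.
by have := shifted_digit hj; rewrite dj0 muln0; nia.
Qed.

Lemma shifted_last_digit : d`[k] = n * d`[0] + c`[1].
Proof.
by case: hc => c0 _; have := shifted_carry_opposite (leq0n k); rewrite c0 subn0; lia.
Qed.

Lemma shifted_first_digit_gt0 : 0 < d`[0].
Proof.
case: hd => [_ _ _ dk0 _]; rewrite lt0n; apply: contra dk0 => /eqP d00.
by rewrite shifted_last_digit d00 (shifted_digit_eq0 d00).2 muln0.
Qed.

(** * The brackets for the carries (0, d_k, ..., d_0, 0) *)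

(** A final 0 does not affect [nth], so the carries (0, d_k, ..., d_0, 0) may be
    represented by the shorter sequence [0 :: d]. *)
Lemma mirror_carriesE i : i <= k ->
  mirror b k.+2 (0 :: d) i.+1 = d`[i] + b * d`[k - i].
Proof. by move=> hi; rewrite /mirror subSS subSn. Qed.

Lemma mirror_carries_first : mirror b k.+2 (0 :: d) 0 = 0.
Proof. by rewrite /mirror /= nth_default ?size_tuple // muln0. Qed.

Lemma mirror_carries_last : mirror b k.+2 (0 :: d) k.+2 = 0.
Proof. by rewrite /mirror subnn /= nth_default ?size_tuple // muln0. Qed.

Variant position : nat -> Prop :=
  | FirstPosition : position 0
  | InnerPosition i of i <= k : position i.+1
  | LastPosition : position k.+2.

Lemma positionP j : j <= k.+2 -> position j.
Proof.
case: j => [|i]; first by constructor.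
by rewrite ltnS leq_eqVlt ltnS => /predU1P [->|]; constructor.
Qed.

(** Vanishing digits have vanishing carries, and the pair
    (d_(i+1), d_(k-i+1)) controls both carries c_(i+1) and c_i = c_(k-i+1)
    of the pair (d_i, d_(k-i)). *)
Lemma mirror_digits_eq0 j : j <= k.+2 ->
  mirror b k.+2 d j = 0 -> mirror b k.+2 (0 :: d) j = 0.
Proof.
case: hd => [hnb _ _ _ _] /positionP [|i hi|].
- by rewrite mirror_carries_first.
- rewrite mirror_carriesE // /mirror subSS subSn // => X0.
  have [/shifted_digit_eq0 [ci1 _] /shifted_digit_eq0 [cki _]] :
    d`[i.+1] = 0 /\ d`[(k - i).+1] = 0 by nia.
  have := shifted_digit_pair hi; rewrite ci1 hshift // addn1 cki.
  by rewrite muln0 addn0 muln0; nia.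
- by rewrite mirror_carries_last.
Qed.

(** A zero digit d_i leaves no carry c_(i+1), and then
    n d_(i+1) <= d_(k-i-1), which is impossible if d_(i+1) = b - 1. *)
Lemma mirror_digits_not_extreme j : j <= k.+2 ->
  ~ (mirror b k.+2 d j = b ^ 2 - 1 /\ mirror b k.+2 (0 :: d) j = 0).
Proof.
case: hd => [hnb _ _ _ _] hj [X_max Y0].
have [dj dKj] : d`[j] = b - 1 /\ d`[k.+2 - j] = b - 1.
  move: X_max (digit_lt j) (digit_lt (k.+2 - j)); rewrite /mirror; move: (d`[j]) (d`[_]).
  by move=> x y; split; nia.
case: (positionP hj) dj dKj Y0 => [|i hi|].
- by rewrite subn0 (nth_default _ (n := k.+2)) ?size_tuple //; lia.
- move=> di1 _; rewrite mirror_carriesE // => Y0.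
  have di0 : d`[i] = 0 by lia.
  have [_ ci1] := shifted_digit_eq0 di0.
  case: (ltnP i k) => hik; last by move: di1; rewrite nth_default ?size_tuple //; lia.
  have := shifted_carry_opposite hik; have := digit_lt (k - i.+1).
  by rewrite ci1 di1; nia.
- by rewrite (nth_default _ (n := k.+2)) ?size_tuple //; lia.
Qed.

(** * Integrality of the new digits *)

Variables (D M alpha : nat) (q : nat -> nat).
Hypotheses (D_gt0 : 0 < D) (hM : b ^ 2 - 1 = D * M).
Hypothesis hq : forall j, j <= k -> D * c`[j] = (n ^ 2 - 1) * q j.

Lemma mirror_carries_quotient j : j <= k ->
  mirror b k.+2 (0 :: d) j = M * (n * q j + prev_term q j).
Proof.
case: hd => [hnb _ _ _ _].
have n2_gt0 : 0 < n ^ 2 - 1 by nia.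
case: j => [|i] hj.
  have := hq hj; case: hc => -> _; rewrite mirror_carries_first /=.
  by rewrite muln0 => /esym/eqP; rewrite muln_eq0 gtn_eqF //= => /eqP ->; rewrite !muln0.
rewrite mirror_carriesE ?(ltnW hj) //=.
have eY := shifted_digit_pair (ltnW hj).
apply/eqP; rewrite -(eqn_pmul2l D_gt0) mulnA -hM -(eqn_pmul2l n2_gt0); apply/eqP.
rewrite mulnCA eY mulnCA.
have := hq hj; have := hq (ltnW hj); move: (n ^ 2 - 1) (b ^ 2 - 1) => N1 N2 h1 h2.
by rewrite [RHS]mulnCA mulnDr !(mulnCA D n) h2 h1; congr (_ * _); lia.
Qed.

Hypothesis hdvd : forall j, j <= k ->
  (D %| ((alpha * (b * d`[k - j + 2] + d`[j]))%N%:Z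
         - (n * q j + prev_term q j)%N%:Z)%R)%Z.

Lemma new_digit_integral j : j <= k.+2 ->
  ((b ^ 2 - 1)%N%:Z %| ((alpha * M * mirror b k.+2 d j)%N%:Z
                 - (mirror b k.+2 (0 :: d) j)%:Z)%R)%Z.
Proof.
case: hd => [hnb k_gt0 _ _ _].
have low i : i <= k ->
    ((b ^ 2 - 1)%N%:Z %| ((alpha * M * mirror b k.+2 d i)%N%:Z
                   - (mirror b k.+2 (0 :: d) i)%:Z)%R)%Z.
  move=> hi; have /dvdzP [z ez] := hdvd hi.
  rewrite mirror_carries_quotient // hM /mirror.
  have -> : k.+2 - i = k - i + 2 by lia.
  by apply/dvdzP; exists z; nia.
move=> hj; case: (leqP j k) => [|j_gt]; first exact: low.
(* the mirror position is at most 1, hence at most k *)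
have /dvdzP [z ez] := low (k.+2 - j) ltac:(lia).
have b_gt0 : 0 < b by lia.
have := mirror_opposite d b_gt0 (leq_subr j k.+2).
have := mirror_opposite (0 :: d) b_gt0 (leq_subr j k.+2).
rewrite subKn //; move: ez.
move: (mirror b k.+2 d _) (mirror b k.+2 (0 :: d) _) => X' Y'.
move: (mirror b k.+2 d _) (mirror b k.+2 (0 :: d) _) => X Y.
move: (nth _ _ _) (nth _ _ _) (b ^ 2 - 1) (alpha * M) => u v N B ez eY eX.
apply/dvdzP; exists (Posz b * z - (B * u)%N%:Z + v%:Z)%R.
have {}eX := congr1 (muln B) eX.
have {}ez := congr1 (GRing.mul (Posz b)) ez.
by nia.
Qed.

End ShiftedSymmetric.

(** * The new palintiple *)

Theorem theorem4 (n b k : nat) (d c : k.+1.-tuple nat) (D : nat) (q : nat -> nat)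
    (hd : palintiple n b d)
    (hc : is_carries n b d c)
    (hshift : shifted_symmetric_carries c)
    (hD : D = gcdn d`[0] (b ^ 2 - 1))
    (hq : forall j, j <= k -> D * c`[j] = (n ^ 2 - 1) * q j)
    (alpha : nat) (halpha : 1 <= alpha)
    (hdvd : forall j, j <= k ->
       (D %| ((alpha * (b * d`[k - j + 2] + d`[j]))%N%:Z
              - (n * q j + prev_term q j)%N%:Z)%R)%Z) :
  exists dhat : k.+3.-tuple nat,
    [/\ palintiple b (alpha * ((b ^ 2 - 1) %/ D)) dhat,
        is_carries b (alpha * ((b ^ 2 - 1) %/ D)) dhat [tuple of 0 :: rcons d 0]
      & asymmetric_carries [tuple of 0 :: rcons d 0]].
Proof.
have [hnb k_gt0 _ _ _] := hd.
have d0_gt0 := shifted_first_digit_gt0 hd hc hshift.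
have d_lt := digit_lt hd.
have D_gt0 : 0 < D by rewrite hD gcdn_gt0 d0_gt0.
have D_lt : D < b.
  by apply: leq_ltn_trans (d_lt 0); rewrite hD dvdn_leq ?dvdn_gcdl.
have hM : b ^ 2 - 1 = D * ((b ^ 2 - 1) %/ D).
  by rewrite mulnC divnK // hD dvdn_gcdr.
move: ((b ^ 2 - 1) %/ D) hM => M hM.
(* b^2 - 1 = (b - 1) (b + 1) and D <= b - 1 *)
have M_gt : b < M by nia.
have B_gt : b < alpha * M by nia.
have N_gt0 : 0 < b ^ 2 - 1 by nia.
have b_gt0 : 0 < b by lia.
set B := alpha * M in B_gt *.
have new_digit (j : 'I_k.+3) : exists e,
    (e < B) && ((b ^ 2 - 1) * e + mirror b k.+2 (0 :: d) j
                == B * mirror b k.+2 d j).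
  have hj : j <= k.+2 by rewrite -ltnS ltn_ord.
  have [|||||||e e_lt eE] := @digit_of_congruence (b ^ 2 - 1) B
    (mirror b k.+2 d j) (mirror b k.+2 (0 :: d) j) => //.
  - by lia.
  - exact: mirror_le.
  - by apply: mirror_le => // -[|i] //=; lia.
  - exact: (mirror_digits_eq0 hd hc hshift).
  - exact: (mirror_digits_not_extreme hd hc hshift).
  - exact: (new_digit_integral hd hc hshift D_gt0 hM hq hdvd).
  by exists e; rewrite e_lt eE eqxx.
pose e := mktuple (fun j => xchoose (new_digit j)).
have eP j : j <= k.+2 -> e`[j] < B /\
    (b ^ 2 - 1) * e`[j] + mirror b k.+2 (0 :: d) j = B * mirror b k.+2 d j.
  move=> hj; have -> : e`[j] = xchoose (new_digit (Ordinal (hj : j < k.+3))).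
    by rewrite -(tnth_nth 0 e (Ordinal (hj : j < k.+3))) tnth_mktuple.
  by have /andP [? /eqP] := xchooseP (new_digit (Ordinal (hj : j < k.+3))).
have sE j : (0 :: rcons d 0)`[j] = (0 :: d)`[j].
  by case: j => //= j; rewrite nth_rcons_default.
have e_carries : is_carries b B e [tuple of 0 :: rcons d 0].
  split=> // j hj /=; rewrite nth_rcons_default sE.
  apply: (carries_of_digits (e := fun i => e`[i]) (s := 0 :: d)) => //; first by lia.
  by move=> i /eP [].
exists e; split=> //.
  apply: palintiple_of_carries e_carries => //; first by lia.
    by move=> j /eP [].
  have [_] := eP k.+2 (leqnn _).
  rewrite mirror_carries_last addn0 /mirror subnn => eK.
  by apply/eqP => eK0; move: eK; rewrite eK0 muln0 => /esym/eqP; rewrite !(muln_eq0, addn_eq0); lia.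
split.
- move=> /(_ 1 isT); rewrite subSS subn0 /= !nth_rcons_default.
  by have := shifted_last_digit hc hshift; nia.
- move=> /(_ 1 isT); rewrite subSS subn0 addn1 /= !nth_rcons_default.
  by rewrite (nth_default _ (n := k.+1)) ?size_tuple //; lia.
Qed.
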